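(* There is an absolute constant $K$ such that the following holds. Let $0\le r_\diamond<m_\diamond$ be integers and let $(r,m)=(r_\diamond-i,m_\diamond-i)$ for some integer $0\le i\le\min(r_\diamond+1,m_\diamond-r_\diamond)$. Then there is a unitary encoder $U^{(0)}(r,m;r_\diamond,m_\diamond)$ of $\mathrm{QRM}^{(0)}(r,m;r_\diamond,m_\diamond)$ on $2^m$ qubits, realized by a circuit of Hadamard gates, CNOT gates and qubit permutations of depth at most $K(m+1)$ (that is, logarithmic in the number of qubits), whose number of CNOT gates is $\zeta^{(0)}(r,m;r_\diamond,m_\diamond)$, where $$\zeta^{(0)}(r,m;r_\diamond,m_\diamond)=\begin{cases}\zeta^c(r_\diamond,m)&\text{if } 2r_\diamond+1\le m_\diamond\text{ and } r=-1,\\ \zeta^c(r_\diamond,r_\diamond)&\text{if } 2r_\diamond+1>m_\diamond\text{ and } m=r_\diamond,\\ \sum_{j=r}^{r_\diamond}\binom{m-1}{j}+2\zeta^{(0)}(r-1,m-1;r_\diamond,m_\diamond)&\text{otherwise,}\end{cases}$$ with $\zeta^c(s,s)=s2^{s-1}$ and $\zeta^c(s,t)=\sum_{j=0}^{s}\binom{t-1}{j}+2\zeta^c(s,t-1)$ for $0\le s<t$.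
   Context: For $0\le r\le m$, $\mathrm{RM}(r,m)\subseteq\mathbb F_2^{2^m}$ is the binary Reed-Muller code: the set of evaluation vectors $\mathrm{Eval}^{(m)}(f)=(f(\boldsymbol\rho(1)),\dots,f(\boldsymbol\rho(2^m)))$ of polynomials $f\in\mathbb F_2[x_1,\dots,x_m]$ of degree at most $r$, where $\boldsymbol\rho(j)$ is the $m$-bit binary representation of $j-1$. Set $\mathrm{RM}(s,m)=\{\mathbf 0\}$ for $s<0$. $\mathrm{QRM}^{(0)}(r,m;r_\diamond,m_\diamond)$ has basis codewords $|\mathbf w\rangle^{(0)}_{r,m}=|\mathrm{RM}(r,m)|^{-1/2}\sum_{\mathbf c\in\mathrm{RM}(r,m)}|\mathbf w\oplus\mathbf c\rangle$, $\mathbf w\in\mathrm{RM}(r_\diamond,m)$, on $2^m$ qubits. With $k=\sum_{j=r+1}^{r_\diamond}\binom mj$, a unitary $U$ on $2^m$ qubits is an encoder of $\mathrm{QRM}^{(0)}(r,m;r_\diamond,m_\diamond)$ if for every $\mathbf m\in\mathbb F_2^k$, $U|\mathbf m\rangle|0\rangle^{\otimes(2^m-k)}=|\mathbf mG_1\rangle^{(0)}_{r,m}$, where the rows of $G_1$ (in some fixed order) are the evaluation vectors of the monomials in $x_1,\dots,x_m$ of degree between $r+1$ and $r_\diamond$. (For $(r,m)=(r_\diamond,m_\diamond)$, $k=0$ and $U$ prepares $|\mathbf 0\rangle^{(0)}_{r,m}$ from $|0\rangle^{\otimes 2^m}$.) Qubit permutations are relabelings of qubits and are not counted in the gate count or the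 depth; depth is the number of layers of gates acting on disjoint qubits. *)

(* Defs.v *)
From HB Require Import structures.
From mathcomp Require Import all_boot all_order all_fingroup all_algebra.
From mathcomp Require Import spectral.
From mathcomp Require Import complex mpoly boolp reals.

Set Implicit Arguments.
Unset Strict Implicit.
Unset Printing Implicit Defensive.

Import GRing.Theory Num.Theory.
Local Open Scope ring_scope.

(* The [m]-bit binary representation of [j], most significant bit first.
   Positions are numbered from 0, so this is rho(j + 1). *)
Definition rho (m : nat) (j : 'I_(2 ^ m)) (a : 'I_m) : 'F_2 :=
  (odd (j %/ 2 ^ (m.-1 - a)))%:R.

Definition eval_vec (m : nat) (f : {mpoly 'F_2[m]}) : 'rV['F_2]_(2 ^ m) :=
  \row_(j < 2 ^ m) f.@[rho j].

(* [msize f] is the total degree plus one, and 0 for [f = 0]. *)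
Definition RM (s : int) (m : nat) : {set 'rV['F_2]_(2 ^ m)} :=
  if s is Posz d then
    [set w | `[< exists f : {mpoly 'F_2[m]},
                   (msize f <= d.+1)%N /\ w = eval_vec f >]]
  else [set 0].

(* States and operators on [n] qubits are column vectors and square matrices
   indexed, through [enum_rank], by the bit strings of length [n]. *)
Definition hdim (n : nat) : nat := #|{: 'rV['F_2]_n}|.

Definition ket (C : numClosedFieldType) (n : nat) (x : 'rV['F_2]_n) :
    'cV[C]_(hdim n) :=
  delta_mx (enum_rank x) 0.

Definition ketRM (C : numClosedFieldType) (r : int) (m : nat)
    (w : 'rV['F_2]_(2 ^ m)) : 'cV[C]_(hdim (2 ^ m)) :=
  (sqrtC (#|RM r m|%:R : C))^-1 *: \sum_(c in RM r m) ket C (w + c).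

(* [op_of f] is the operator with matrix entries <y| op |x> = f y x. *)
Definition op_of (C : numClosedFieldType) (n : nat)
    (f : 'rV['F_2]_n -> 'rV['F_2]_n -> C) : 'M[C]_(hdim n) :=
  \matrix_(i, j) f (enum_val i) (enum_val j).

Inductive gate (n : nat) : Type :=
  | Had of 'I_n
  | Cnot of 'I_n & 'I_n. (* control, target *)

Definition gate_qubits (n : nat) (g : gate n) : seq 'I_n :=
  match g with
  | Had a => [:: a]
  | Cnot a b => [:: a; b]
  end.

Definition is_cnot (n : nat) (g : gate n) : bool :=
  if g is Cnot _ _ then true else false.

Definition gate_mx (C : numClosedFieldType) (n : nat) (g : gate n) :
    'M[C]_(hdim n) :=
  match g with
  | Had a => op_of (fun y x : 'rV['F_2]_n =>
      if [forall b, (b != a) ==> (y 0 b == x 0 b)]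
      then (sqrtC 2)^-1 * (-1) ^+ ((x 0 a == 1) && (y 0 a == 1)) else 0)
  | Cnot a b => op_of (fun y x : 'rV['F_2]_n =>
      (y == x + x 0 a *: delta_mx 0 b)%:R)
  end.

(* The relabeling [p] sends the qubit at position [a] to position [p a]. *)
Definition relabel_mx (C : numClosedFieldType) (n : nat) (p : 'S_n) :
    'M[C]_(hdim n) :=
  op_of (fun y x : 'rV['F_2]_n => [forall a, y 0 (p a) == x 0 a]%:R).

Inductive step (n : nat) : Type :=
  | Layer of seq (gate n)
  | Relabel of 'S_n.

(* The head of the sequence is applied first. *)
Definition circuit (n : nat) : Type := seq (step n).

(* The gates of a layer act on disjoint qubits; in particular the control and
   the target of a CNOT are distinct. *)
Definition wf_step (n : nat) (s : step n) : bool :=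
  if s is Layer l then uniq (flatten (map (@gate_qubits n) l)) else true.

Definition wf_circuit (n : nat) (c : circuit n) : bool := all (@wf_step n) c.

Definition layer_mx (C : numClosedFieldType) (n : nat) (l : seq (gate n)) :
    'M[C]_(hdim n) :=
  foldl (fun U g => gate_mx C g *m U) 1%:M l.

Definition step_mx (C : numClosedFieldType) (n : nat) (s : step n) :
    'M[C]_(hdim n) :=
  match s with
  | Layer l => layer_mx C l
  | Relabel p => relabel_mx C p
  end.

Definition circuit_mx (C : numClosedFieldType) (n : nat) (c : circuit n) :
    'M[C]_(hdim n) :=
  foldl (fun U s => step_mx C s *m U) 1%:M c.

Definition depth (n : nat) (c : circuit n) : nat :=
  count (fun s => if s is Layer _ then true else false) c.

Definition cnot_count (n : nat) (c : circuit n) : nat :=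
  sumn (map (fun s => if s is Layer l then count (@is_cnot n) l else 0%N) c).

Definition msg_len (r : int) (m rd : nat) : nat :=
  (\sum_(j < rd.+1 | (r < (j : nat)%:Z)%R) 'C(m, j))%N.

(* [ms] lists, in some order and without repetition, the squarefree monomials
   of degree between [r + 1] and [rd]; x_a ^ 2 and x_a are the same function
   on F_2, so only squarefree monomials are rows of G_1. *)
Definition monomial_order (r : int) (m rd : nat) (ms : seq 'X_{1..m}) : Prop :=
  uniq ms /\
  forall u : 'X_{1..m},
    (u \in ms) =
      [&& [forall a : 'I_m, (u a <= 1)%N], r < (mdeg u)%:Z & (mdeg u <= rd)%N].

Definition gen_mx (m k : nat) (ms : k.-tuple 'X_{1..m}) :
    'M['F_2]_(k, 2 ^ m) :=
  \matrix_(i < k) eval_vec ('X_[tnth ms i] : {mpoly 'F_2[m]}).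

(* The string [v] followed by zeros, of total length [n] (for [k <= n]). *)
Definition pad0 (k n : nat) (v : 'rV['F_2]_k) : 'rV['F_2]_n :=
  \row_(j < n) (if insub (j : nat) is Some i then v 0 (i : 'I_k) else 0).

(* Encoders of QRM^(0)(r, m; rd, md), for the order [ms] of the rows of G_1;
   the code depends on [md] only through [m]. *)
Definition is_encoder (C : numClosedFieldType) (r : int) (m rd : nat)
    (ms : (msg_len r m rd).-tuple 'X_{1..m}) (U : 'M[C]_(hdim (2 ^ m))) : Prop :=
  U \is unitarymx /\
  forall v : 'rV['F_2]_(msg_len r m rd),
    U *m ket C (pad0 (2 ^ m) v) = ketRM C r (v *m gen_mx ms).

(* Meaningful for [s <= t]. *)
Fixpoint zetac (s t : nat) : nat :=
  if t == s then (s * 2 ^ s.-1)%N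
  else if t is t'.+1 then (\sum_(j < s.+1) 'C(t', j) + 2 * zetac s t')%N
  else 0%N.

(* Meaningful for [(r, m) = (rd - i, md - i)] with
   [i <= min (rd + 1) (md - rd)]; the value 0 is then never reached through
   the last line. *)
Fixpoint zeta0 (rd md : nat) (r : int) (m : nat) : nat :=
  if (2 * rd + 1 <= md)%N && (r == -1) then zetac rd m
  else if (md < 2 * rd + 1)%N && (m == rd) then zetac rd rd
  else if m is m'.+1 then
    (\sum_(j < rd.+1 | (r <= (j : nat)%:Z)%R) 'C(m', j)
       + 2 * zeta0 rd md (r - 1)%R m')%N
  else 0%N.

(* Main.v *)
Require Import Defs.
From HB Require Import structures.
From mathcomp Require Import all_boot all_order all_fingroup all_algebra.
From mathcomp Require Import spectral.
From mathcomp Require Import complex mpoly boolp reals.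
From mathcomp Require Import zify ring.

Set Implicit Arguments.
Unset Strict Implicit.
Unset Printing Implicit Defensive.

Import GRing.Theory Num.Theory.
Local Open Scope ring_scope.

(** Qubits are indexed by the squarefree monomials in [x_1, ..., x_m]. A message is
    placed on the monomials of degree between [r + 1] and [rd], Hadamard gates put
    the monomials of degree at most [r] in uniform superposition, and the butterfly
    [f0 + x_i f1 |-> (f0, f0 + f1)], one layer of CNOTs per variable, evaluates the
    polynomial with these coefficients. A CNOT is dropped when its control is always
    zero (degree above [rd]), or when its target lies in the superposed part (control
    of degree below [r] in the remaining variables, [r] decreasing by one per stage).
    The circuit of CNOTs acts on basis states by an invertible linear map [B], so it
    is enough that [B] sends each monomial of degree at most [rd] to its evaluation
    vector modulo [RM(r, m)]: then [B] maps the span of the monomials of degree at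
    most [r] into [RM(r, m)], and onto it by counting. *)

(** * Counting gates *)

(* Whether stage [i] of the circuit, which adds the variable [x_i], keeps the
   CNOT whose control is a monomial of degree [w] in the variables after [x_i].
   Here [rho] is [r + 1]; the disjunct [m - i <= rd] is the base case
   zeta^c(rd, rd), where nothing is skipped. *)
Definition stage_weight (rd rho m i w : nat) : bool :=
  (w <= rd)%N && ((rho <= (w + i).+1)%N || (m - i <= rd)%N).

(** The factor [2 ^ i] counts the arbitrary values of the variables before [x_i]; the sum counts the
    admissible monomials in the variables after it. *)
Definition stage_count (rd rho m i : nat) : nat :=
  (2 ^ i * \sum_(j < rd.+1 | stage_weight rd rho m i j) 'C(m - i.+1, j))%N.

Definition butterfly_count (rd rho m : nat) : nat :=
  (\sum_(i < m) stage_count rd rho m i)%N.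

(** Once the first variable is evaluated, two copies of a butterfly on [m] variables remain.
    Shifting the stage index by one lowers the threshold [rho] by one; at [rho = 0] the threshold
    condition always holds, so truncation is harmless. *)
Lemma butterfly_countS rd rho m :
  butterfly_count rd rho m.+1 =
  (\sum_(j < rd.+1 | stage_weight rd rho m.+1 0 j) 'C(m, j)
     + 2 * butterfly_count rd rho.-1 m)%N.
Proof.
rewrite /butterfly_count big_ord_recl /stage_count /= expn0 mul1n subSS subn0.
congr (_ + _)%N; rewrite big_distrr /=; apply: eq_bigr => i _.
rewrite mulnA -expnS /bump leq0n add1n subSS; congr (_ * _)%N.
apply: eq_bigl => j; rewrite /stage_weight subSS addnS.
by case: rho => [|rho].
Qed.

Lemma sum_binomial_trunc n s : (n <= s)%N -> (\sum_(j < s.+1) 'C(n, j) = 2 ^ n)%N.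
Proof.
move=> le_ns; rewrite -(subnKC le_ns) -addSn big_split_ord /= [X in (_ + X)%N]big1.
  rewrite addn0 -[2%N]/(1 + 1)%N Pascal; apply: eq_bigr => i _.
  by rewrite !exp1n !muln1.
by move=> i _; rewrite bin_small // ltn_addr.
Qed.

(** Nothing is dropped, so each of the [m] stages pairs up all positions and has [2 ^ m.-1]
    gates. *)
Lemma butterfly_count_full rd rho m :
  (m <= rd)%N -> butterfly_count rd rho m = (m * 2 ^ m.-1)%N.
Proof.
move=> le_m; transitivity (\sum_(i < m) 2 ^ m.-1)%N; last first.
  by rewrite sum_nat_const card_ord.
apply: eq_bigr => i _; rewrite /stage_count.
have lt_i := ltn_ord i.
rewrite (eq_bigl predT) => [|j]; last first.
  by rewrite /stage_weight -ltnS ltn_ord (leq_trans (leq_subr _ _) le_m) orbT.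
rewrite sum_binomial_trunc; last by lia.
by rewrite -expnD; congr (2 ^ _)%N; lia.
Qed.

Lemma zetacE s m : (s <= m)%N -> zetac s m = butterfly_count s 0 m.
Proof.
elim: m => [|m IHm] le_sm.
  have -> : s = 0%N by lia.
  by rewrite /= /butterfly_count big_ord0.
rewrite /=; case: eqP => [<-|ne_sm]; first by rewrite butterfly_count_full.
rewrite butterfly_countS IHm; last by lia.
congr (_ + _)%N; apply: eq_bigl => j.
by rewrite /stage_weight -ltnS ltn_ord.
Qed.

(** The recursion of [zeta0] peels off one variable and raises [t] by one. Its first base case is
    [rho = 0], its second is [m = rd], where no gate is dropped. *)
Lemma zeta0E rd md t :
  (rd < md)%N -> (t <= minn rd.+1 (md - rd))%N ->
  zeta0 rd md (rd%:Z - t%:Z) (md - t) = butterfly_count rd (rd.+1 - t) (md - t).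
Proof.
move=> lt_rd; rewrite leq_min => /andP[le_t1 le_t2].
move Em: (md - t)%N => m.
elim: m t le_t1 le_t2 Em => [|m IHm] t le_t1 le_t2 Em /=.
  have [-> ->] : rd = 0%N /\ t = md by lia.
  have -> : md = 1%N by lia.
  by rewrite /butterfly_count big_ord0.
case: ifP => [/andP[md_ge /eqP r_eq]|c1].
  have [-> e2] : t = rd.+1 /\ (rd <= m.+1)%N by lia.
  by rewrite subnn -zetacE.
case: ifP => [/andP[md_lt /eqP m_eq]|c2].
  have -> : zetac rd rd = (rd * 2 ^ rd.-1)%N.
    by rewrite zetacE // butterfly_count_full.
  by rewrite butterfly_count_full m_eq.
(* Outside both base cases neither bound on [t] is attained: equality in one, with the other bound,
   forces a base case. *)
have [lt1 lt2 e3] : [/\ (t.+1 <= rd.+1)%N, (t.+1 <= md - rd)%N & (rd < m.+1)%N].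
  by split; lia.
have -> : (rd%:Z - t%:Z - 1)%R = rd%:Z - t.+1%:Z by lia.
rewrite (IHm t.+1) //; last by lia.
have -> : (rd.+1 - t = (rd.+1 - t.+1).+1)%N by lia.
rewrite butterfly_countS; congr (_ + _)%N; apply: eq_bigl => j.
have := ltn_ord j; rewrite /stage_weight => ltj.
by apply/idP/idP; lia.
Qed.

(** * Positions and partially evaluated monomials *)

Lemma bits_inj m j k :
  (j < 2 ^ m)%N -> (k < 2 ^ m)%N ->
  (forall a, (a < m)%N -> odd (j %/ 2 ^ a) = odd (k %/ 2 ^ a)) -> j = k.
Proof.
elim: m j k => [|m IHm] j k; first by rewrite expn0 !ltnS !leqn0 => /eqP-> /eqP->.
move=> ltj ltk eqb.
have e0 : odd j = odd k by have := eqb 0%N isT; rewrite !divn1.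
have eh : j./2 = k./2.
  apply: IHm => [||a lta].
  - by rewrite -divn2 ltn_divLR // -expnSr.
  - by rewrite -divn2 ltn_divLR // -expnSr.
  by have := eqb a.+1 lta; rewrite expnS !divnMA !divn2.
by rewrite -[j]odd_double_half -[k]odd_double_half e0 eh.
Qed.

Section Positions.

Variable m : nat.
Implicit Types (p q : {set 'I_m}) (i l : 'I_m) (j : 'I_(2 ^ m)).

Definition bits j : {set 'I_m} := [set a : 'I_m | odd (j %/ 2 ^ (m.-1 - a))].

Lemma rhoE j i : rho j i = (i \in bits j)%:R.
Proof. by rewrite inE. Qed.

Lemma bits_injective : injective bits.
Proof.
move=> j k /setP eqb; apply/val_inj/(bits_inj (ltn_ord j) (ltn_ord k)) => a lta.
have lta' : (m.-1 - a < m)%N by lia.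
have := eqb (Ordinal lta'); rewrite !inE /=.
by have -> : (m.-1 - (m.-1 - a) = a)%N by lia.
Qed.

Lemma bits_codom p : p \in codom bits.
Proof.
apply: inj_card_onto bits_injective _ p.
by have := card_powerset [set: 'I_m]; rewrite powersetT !cardsT !card_ord => ->.
Qed.

(** [bits] and [pos] identify positions with sets of variables, hence both with evaluation points
    and with squarefree monomials. *)
Definition pos p : 'I_(2 ^ m) := iinv (bits_codom p).

Lemma posK : cancel pos bits.
Proof. by move=> p; rewrite /pos f_iinv. Qed.

Lemma bitsK : cancel bits pos.
Proof. by move=> j; apply: bits_injective; rewrite posK. Qed.

Lemma pos_inj : injective pos.
Proof. exact: can_inj posK. Qed.

Definition unit_word p : 'rV['F_2]_(2 ^ m) := delta_mx 0 (pos p).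

Definition from (l : nat) : {set 'I_m} := [set i : 'I_m | (l <= i)%N].

Lemma from0 : from 0 = setT.
Proof. by apply/setP => i; rewrite !inE. Qed.

Lemma card_from (l : nat) : #|from l| = (m - l)%N.
Proof.
have [lem|gtm] := leqP l m; last first.
  apply/eqP; rewrite (_ : (m - l)%N = 0%N); last by lia.
  rewrite cards_eq0; apply/eqP/setP => i; rewrite !inE.
  by have := ltn_ord i; lia.
have := cardsC (from l); rewrite card_ord.
suff -> : #|~: from l| = l by lia.
have winj : injective (widen_ord lem) by move=> a b [] /val_inj.
rewrite -[RHS]card_ord -cardsT -(card_imset _ winj).
apply: eq_card => i; rewrite !inE -ltnNge; apply/idP/imsetP => [lti|[i' _ ->]].
  by exists (Ordinal lti) => //; apply/val_inj.
exact: ltn_ord i'.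
Qed.

Lemma leq_ord_neq l i : i != l -> (l <= i)%N = (l < i)%N.
Proof. by rewrite -val_eqE /= => nei; rewrite ltn_neqAle eq_sym nei. Qed.

Lemma card_setI_from_mem l p :
  l \in p -> #|p :&: from l| = #|p :&: from l.+1|.+1.
Proof.
move=> lp; rewrite (cardsD1 l) !inE lp leqnn add1n; congr _.+1.
apply: eq_card => i; rewrite !inE; have [->|nei] := eqVneq i l.
  by rewrite ltnn andbF.
by rewrite leq_ord_neq.
Qed.

Lemma card_setI_from_notin l p :
  l \notin p -> #|p :&: from l| = #|p :&: from l.+1|.
Proof.
move=> lp; apply: eq_card => i; rewrite !inE; have [->|nei] := eqVneq i l.
  by rewrite (negPf lp).
by rewrite leq_ord_neq.
Qed.

Lemma setU1_setI_from l p : (l |: p) :&: from l.+1 = p :&: from l.+1.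
Proof.
by apply/setP => i; rewrite !inE; have [->|] := eqVneq i l; rewrite ?ltnn ?andbF.
Qed.

(* The variables below [l] are already evaluated, at the bits of [p]; those from
   [l] on still form the monomial indexed by [p]. *)
Definition half_eval (l : nat) p : 'rV['F_2]_(2 ^ m) :=
  \row_j \prod_(i < m) (if (i < l)%N then (i \in bits j) == (i \in p)
                        else (i \in p) ==> (i \in bits j))%:R.

Lemma half_eval_full p : half_eval m p = unit_word p.
Proof.
apply/rowP => j; rewrite !mxE eqxx -(inj_eq bits_injective) posK /=.
case: eqP => [->|/eqP ne_jp].
  by rewrite big1 // => i _; rewrite ltn_ord eqxx.
have [i nei] : exists i, (i \in bits j) != (i \in p).
  apply/existsP; apply: contraNT ne_jp => /existsPn eqb.
  by apply/eqP/setP => i; apply/eqP; rewrite -[_ == _]negbK eqb.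
by apply/eqP; rewrite prodf_seq_eq0; apply/hasP; exists i;
  rewrite ?mem_index_enum //= ltn_ord (negPf nei).
Qed.

(** Isolates the factor of [x_l]. The cofactor is common to levels [l] and [l.+1] and to sets that
    agree off [l], so the identities below reduce to that single factor. *)
Lemma half_eval_split l p q j (k : nat) :
    (forall i, i != l -> (i \in p) = (i \in q)) -> (k = l \/ k = l.+1) ->
  half_eval k p 0 j =
  (if (l < k)%N then (l \in bits j) == (l \in p)
   else (l \in p) ==> (l \in bits j))%:R *
  \prod_(i < m | i != l)
     (if (i < l)%N then (i \in bits j) == (i \in q)
      else (i \in q) ==> (i \in bits j))%:R.
Proof.
move=> eq_pq k_eq; rewrite mxE (bigD1 l) //=; congr (_ * _).
apply: eq_bigr => i nei; rewrite eq_pq //.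
suff -> : (i < k)%N = (i < l)%N by [].
have nei' : (i : nat) != l by [].
by case: k_eq => ->; lia.
Qed.

(** The indicator of [x_l = 1] is [x_l] itself. *)
Lemma half_eval_mem l p : l \in p -> half_eval l.+1 p = half_eval l p.
Proof.
move=> lp; apply/rowP => j.
rewrite (@half_eval_split l p p) //; last by right.
rewrite (@half_eval_split l p p j l) //; last by left.
by rewrite ltnSn ltnn lp /= eqb_id.
Qed.

(* 1 = (1 + x_l) + x_l *)
Lemma half_eval_notin l p :
  l \notin p -> half_eval l p = half_eval l.+1 p + half_eval l.+1 (l |: p).
Proof.
move=> lp; apply/rowP => j; rewrite [RHS]mxE.
rewrite (@half_eval_split l p p) //; last by left.
rewrite (@half_eval_split l p p j l.+1) //; last by right.
rewrite (@half_eval_split l (l |: p) p j l.+1) //; first last.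
- by right.
- by move=> i nei; rewrite !inE (negPf nei).
rewrite ltnSn ltnn (negPf lp) setU11 /= -mulrDl.
by case: (l \in bits j); rewrite /= ?addr0 ?add0r.
Qed.

(** For [l <= m], [half_eval l q] is a product of [l] affine factors and a monomial of degree
    [#|q :&: from l|]. The generators are thus those of degree below [rho], and level 0 gives RM(rho
    - 1, m). *)
Definition half_eval_span (rho l : nat) : {vspace 'rV['F_2]_(2 ^ m)} :=
  (\sum_(q : {set 'I_m} | (#|(q :&: from l)%SET| + l < rho)%N) <[half_eval l q]>)%VS.

Lemma half_eval_spanP rho (l : nat) q :
  (#|q :&: from l| + l < rho)%N -> half_eval l q \in half_eval_span rho l.
Proof.
move=> ltq; rewrite /half_eval_span memvE.
exact: (sumv_sup _ ltq).
Qed.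

(** An evaluated factor is [x_l] or [1 + x_l]. The first already occurs at level [l]; the second
    gives a difference of two generators of level [l], still of degree below [rho]. *)
Lemma half_eval_span_mono rho (l : 'I_m) :
  (half_eval_span rho l.+1 <= half_eval_span rho l)%VS.
Proof.
apply/subv_sumP => q ltq; rewrite -memvE.
have [lq|lq] := boolP (l \in q).
  by rewrite half_eval_mem // half_eval_spanP // card_setI_from_mem // addSnnS.
rewrite -(addrK (half_eval l.+1 (l |: q)) (half_eval _ _)) -half_eval_notin //.
rewrite half_eval_mem ?setU11 // memvB // half_eval_spanP //.
  by rewrite card_setI_from_notin // (leq_trans _ ltq) // addnS.
by rewrite card_setI_from_mem ?setU11 // setU1_setI_from addSnnS.
Qed.

End Positions.

(** * The linear map of the CNOT circuit *)

Section Butterfly.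

Variables rd rho m : nat.
Implicit Types (p q : {set 'I_m}) (l : 'I_m).

Definition stage_active l p : bool :=
  (l \notin p) && stage_weight rd rho m l #|p :&: from m l.+1|.

(** Words are row vectors acted on from the right: the summand at [p] adds the bit of the control
    [p] to the target [l |: p]. *)
Definition stage_shift l : 'M['F_2]_(2 ^ m) :=
  \sum_(p | stage_active l p) delta_mx (pos p) (pos (l |: p)).

Definition stage_mx l : 'M['F_2]_(2 ^ m) := 1%:M + stage_shift l.

Definition butterfly_mx (ls : seq 'I_m) : 'M['F_2]_(2 ^ m) :=
  foldr (fun l B => stage_mx l *m B) 1%:M ls.

Lemma unit_word_stage l p :
  unit_word p *m stage_mx l =
  unit_word p + (if stage_active l p then unit_word (l |: p) else 0).
Proof.
rewrite mulmxDr mulmx1 mulmx_sumr; congr (_ + _).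
have mul0 q : q != p -> unit_word p *m delta_mx (pos q) (pos (l |: q)) = 0.
  by move=> neq; rewrite mul_delta_mx_0 // (inj_eq (@pos_inj m)) eq_sym.
case: ifPn => act; last first.
  by rewrite big1 // => q act_q; apply/mul0; apply: contraNneq act => <-.
by rewrite (bigD1 p) //= mul_delta_mx big1 ?addr0 // => q /andP[_ neq]; exact: mul0.
Qed.

(** Every target contains [l] and no control does, so the shift squares to zero; the cross terms
    cancel in characteristic 2. *)
Lemma stage_mx_invol l : stage_mx l *m stage_mx l = 1%:M.
Proof.
rewrite /stage_mx mulmxDl mul1mx mulmxDr mulmx1.
have -> : stage_shift l *m stage_shift l = 0.
  rewrite mulmx_suml big1 // => p _; rewrite mulmx_sumr big1 // => q /andP[lq _].
  rewrite mul_delta_mx_0 // (inj_eq (@pos_inj m)).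
  by apply: contraNneq lq => <-; rewrite setU11.
rewrite addr0 -addrA (_ : stage_shift l + _ = 0) ?addr0 //.
by apply/matrixP => i j; rewrite [LHS]mxE [RHS]mxE addrr_pchar2 // pchar_Fp.
Qed.

Lemma butterfly_mx_inj ls (u v : 'rV['F_2]_(2 ^ m)) :
  u *m butterfly_mx ls = v *m butterfly_mx ls -> u = v.
Proof.
elim: ls u v => [|l ls IHls] u v; rewrite /= ?mulmx1 //.
rewrite !mulmxA => /IHls eq_uv.
by rewrite -[u]mulmx1 -[v]mulmx1 -(stage_mx_invol l) !mulmxA eq_uv.
Qed.

(* A gate skipped at stage [l] although its control has degree at most [rd] would
   only have changed the result by an element of the span. *)
Lemma butterfly_mx_drop (l : nat) p :
  (l <= m)%N -> (#|p :&: from m l| <= rd)%N ->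
  unit_word p *m butterfly_mx (drop l (enum 'I_m)) - half_eval l p
    \in half_eval_span m rho l.
Proof.
move Ek: (m - l)%N => k.
elim: k l p Ek => [|k IHk] l p Ek le_lm le_p.
  have -> : l = m by lia.
  rewrite drop_oversize ?size_enum_ord // mulmx1 half_eval_full subrr.
  exact: mem0v.
have lt_lm : (l < m)%N by lia.
pose lo := Ordinal lt_lm.
have -> : drop l (enum 'I_m) = lo :: drop l.+1 (enum 'I_m).
  rewrite (drop_nth lo) ?size_enum_ord //; congr (_ :: _).
  by apply/val_inj; rewrite /= nth_enum_ord.
have IH q : (#|q :&: from m l.+1| <= rd)%N ->
    unit_word q *m butterfly_mx (drop l.+1 (enum 'I_m)) - half_eval l.+1 q
      \in half_eval_span m rho l.
  move=> le_q; apply: (subvP (half_eval_span_mono (m := m) rho lo)).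
  by apply: IHk => //; lia.
rewrite /= mulmxA unit_word_stage mulmxDl.
set B := butterfly_mx _ in IH *.
have [lp|lp] := boolP (lo \in p).
  rewrite /stage_active lp /= mul0mx addr0 -(half_eval_mem (l := lo)) //.
  by apply: IH; move: le_p; rewrite (card_setI_from_mem (l := lo)) //; exact: ltnW.
have le_p' : (#|p :&: from m l.+1| <= rd)%N.
  by rewrite -(card_setI_from_notin (l := lo)).
have -> : half_eval l p = half_eval l.+1 p + half_eval l.+1 (lo |: p).
  exact: (half_eval_notin (l := lo)).
(* The two halves of [half_eval l p] are matched with the unit word at [p] and with the one that the
   gate adds at [lo |: p]. *)
rewrite opprD addrACA memvD ?IH //.
case: ifPn => [act|nact].
  by apply: IH; rewrite (setU1_setI_from lo).
rewrite mul0mx add0r memvN (half_eval_mem (l := lo)) ?setU11 //.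
apply: half_eval_spanP.
(* With [w] the degree of the control, a gate skipped although [w <= rd] has [w + l + 1 < rho]. This
   is the span condition for [lo |: p], whose remaining degree is [w + 1]. *)
rewrite (card_setI_from_mem (l := lo)) ?setU11 // (setU1_setI_from lo) /=.
by move: nact; rewrite /stage_active lp /= /stage_weight /= le_p'; lia.
Qed.

Lemma butterfly_mx_unit p :
  (#|p| <= rd)%N ->
  unit_word p *m butterfly_mx (enum 'I_m) - half_eval 0 p
    \in half_eval_span m rho 0.
Proof.
move=> le_p; have := @butterfly_mx_drop 0 p (leq0n _).
by rewrite from0 setIT drop0 => /(_ le_p).
Qed.

End Butterfly.

(** * Reed-Muller codes as spans of monomials and as images of low-degree words *)

Section ReedMuller.

Variable m : nat.
Implicit Types (p q : {set 'I_m}) (u v : 'X_{1..m}).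

Definition mnm_support u : {set 'I_m} := [set i | u i != 0%N].

(** Positive powers of a variable all define the same function on ['F_2]. *)
Lemma eval_vec_monomial u : eval_vec ('X_[u]) = half_eval 0 (mnm_support u).
Proof.
apply/rowP => j; rewrite !mxE mevalX; apply: eq_bigr => i _.
rewrite ltn0 rhoE (_ : (i \in mnm_support u) = (u i != 0%N)) ?inE //.
by case: (u i) (odd _) => [|k] [] //=; rewrite ?expr1n // expr0n.
Qed.

Lemma card_mnm_support u : (#|mnm_support u| <= mdeg u)%N.
Proof.
rewrite mdegE -sum1_card big_mkcond /=; apply: leq_sum => i _.
by rewrite inE; case: (u i).
Qed.

Lemma mnm_support_inj u v :
  (forall i, (u i <= 1)%N) -> (forall i, (v i <= 1)%N) ->
  mnm_support u = mnm_support v -> u = v.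
Proof.
move=> u1 v1 /setP eq_uv; apply/mnmP => i.
by move: (eq_uv i) (u1 i) (v1 i); rewrite !inE; case: (u i) (v i) => [|[|]] [|[|]].
Qed.

Lemma card_mnm_support_sqfree u :
  (forall i, (u i <= 1)%N) -> #|mnm_support u| = mdeg u.
Proof.
move=> u1; rewrite mdegE -sum1_card big_mkcond /=; apply: eq_bigr => i _.
by rewrite inE; move: (u1 i); case: (u i) => [|[|]].
Qed.

(** A polynomial is a sum of monomials, whose supports are no larger than their degrees; conversely
    each set is the support of a squarefree monomial. For [rho = 0] the family is empty and both
    sides are zero. *)
Lemma RM_half_eval_span rho :
  RM (rho%:Z - 1) m = [set w | w \in half_eval_span m rho 0].
Proof.
case: rho => [|d].
  by apply/setP => w; rewrite !inE /half_eval_span big_pred0 ?memv0.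
have -> : d.+1%:Z - 1 = d%:Z by lia.
apply/setP => w; rewrite !inE; apply/asboolP/idP => [[f [szf ->]]|].
  have -> : eval_vec f =
      \sum_(u <- msupp f) f@_u *: half_eval 0 (mnm_support u).
    apply/rowP => j; rewrite summxE mxE mevalE; apply: eq_bigr => u _.
    by rewrite -eval_vec_monomial !mxE mevalX.
  rewrite big_seq; apply: memv_suml => u u_f; apply/memvZ/half_eval_spanP.
  rewrite addn0 from0 setIT (leq_ltn_trans (card_mnm_support u)) //.
  exact: leq_trans (msize_mdeg_lt u_f) szf.
case/memv_sumP => vs vsP ->.
apply: (big_ind (fun w => exists f : {mpoly 'F_2[m]},
                   (msize f <= d.+1)%N /\ w = eval_vec f)) => [|x y [f [szf ->]] [g [szg ->]]|q ltq].
- by exists 0; rewrite mmeasure0; split => //; apply/rowP => j; rewrite !mxE meval0.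
- exists (f + g); split; last by apply/rowP => j; rewrite !mxE mevalD.
  by rewrite (leq_trans (mmeasureD_le _ _ _)) // geq_max szf.
have /vlineP[k ->] := vsP q ltq.
pose u : 'X_{1..m} := [multinom (i \in q : nat) | i < m].
have uq : mnm_support u = q.
  by apply/setP => i; rewrite inE mnmE; case: (i \in q).
exists (k *: 'X_[u]); split; last first.
  by apply/rowP => j; rewrite -[in LHS]uq -eval_vec_monomial !mxE mevalZ.
have deg_u : (mdeg u <= d)%N.
  rewrite -card_mnm_support_sqfree ?uq => [|i]; last by rewrite mnmE leq_b1.
  by move: ltq; rewrite addn0 from0 setIT.
by rewrite (leq_trans (mmeasureZ_le _ _ _)) // mmeasureX ltnS.
Qed.

End ReedMuller.

Definition words_on (n : nat) (s : {set 'I_n}) : {set 'rV['F_2]_n} :=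
  [set c : 'rV['F_2]_n | [forall j, (c 0 j != 0) ==> (j \in s)]].

Lemma words_onP n (s : {set 'I_n}) (c : 'rV['F_2]_n) :
  reflect (forall j, j \notin s -> c 0 j = 0) (c \in words_on s).
Proof.
rewrite inE; apply: (iffP forallP) => [cs j js|cs j].
  by apply/eqP; apply: contraNT js => cj; have := cs j; rewrite cj.
by apply/implyP; apply: contraNT => js; apply/eqP/cs.
Qed.

Lemma F2_eq01 (a : 'F_2) : a = (a != 0)%:R.
Proof. by case: a => [[|[|]]] // lt2; apply/val_inj. Qed.

Lemma card_words_on n (s : {set 'I_n}) : #|words_on s| = (2 ^ #|s|)%N.
Proof.
pose f (t : {set 'I_n}) : 'rV['F_2]_n := \row_j (j \in t)%:R.
have fE t j : (f t 0 j != 0) = (j \in t) by rewrite mxE; case: (j \in t).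
have f_inj : injective f.
  by move=> t1 t2 eq_f; apply/setP => j; rewrite -!fE eq_f.
rewrite -card_powerset -(card_imset _ f_inj); apply: eq_card => c.
apply/idP/imsetP => [cs|[t ts ->]]; last first.
  by move: ts; rewrite !inE => /subsetP ts; apply/forallP => j; rewrite fE;
    apply/implyP/ts.
exists [set j | c 0 j != 0]; last by apply/rowP => j; rewrite mxE inE -F2_eq01.
by rewrite inE; apply/subsetP => j; rewrite inE; move: cs; rewrite inE => /forallP/(_ j)/implyP.
Qed.

Definition low_degree (rho m : nat) : {set 'I_(2 ^ m)} :=
  [set j | (#|bits j| < rho)%N].

Lemma butterfly_mx_low_degree rd rho m :
  (rho <= rd.+1)%N ->
  [set c *m butterfly_mx rd rho (enum 'I_m) | c in words_on (low_degree rho m)]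
    = RM (rho%:Z - 1) m.
Proof.
move=> le_rho; rewrite RM_half_eval_span; set B := butterfly_mx _ _ _.
apply/eqP; rewrite eqEcard; apply/andP; split.
  apply/subsetP => _ /imsetP[c /words_onP cA ->]; rewrite inE.
  rewrite [c]row_sum_delta mulmx_suml memv_suml // => j _; rewrite -scalemxAl.
  have [jA|jA] := boolP (j \in low_degree rho m); last by rewrite cA // scale0r mem0v.
  move: jA; rewrite inE => ltj; apply: memvZ.
  rewrite -[j]bitsK -/(unit_word _).
  rewrite -[_ *m B](subrK (half_eval 0 (bits j))) memvD //.
    by rewrite butterfly_mx_unit // -ltnS (leq_trans ltj).
  by rewrite half_eval_spanP // addn0 from0 setIT.
rewrite card_imset; last exact: butterfly_mx_inj.
(* [M] sends coefficients to evaluations. Low-degree coefficient words reach the whole span, which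
   bounds its cardinal by theirs. *)
pose M (c : 'rV['F_2]_(2 ^ m)) := \sum_j c 0 j *: half_eval 0 (bits j).
apply: leq_trans (leq_imset_card M _); apply/subset_leq_card/subsetP => w.
rewrite inE => /memv_sumP[vs vsP ->].
apply: (big_ind (fun w => w \in M @: words_on (low_degree rho m))) => [|x y|q ltq].
- apply/imsetP; exists 0; first by apply/words_onP => j _; rewrite mxE.
  by rewrite /M big1 // => j _; rewrite mxE scale0r.
- move=> /imsetP[c1 /words_onP c1A ->] /imsetP[c2 /words_onP c2A ->].
  apply/imsetP; exists (c1 + c2).
    by apply/words_onP => j jA; rewrite mxE c1A // c2A // addr0.
  by rewrite /M -big_split /=; apply: eq_bigr => j _; rewrite mxE scalerDl.
have /vlineP[k ->] := vsP q ltq.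
apply/imsetP; exists (k *: unit_word q).
  apply/words_onP => j; rewrite !mxE eqxx /= => jA.
  case: eqP => [ej|]; last by rewrite mulr0.
  by move: jA ltq; rewrite ej inE posK addn0 from0 setIT => /negPf->.
rewrite /M (bigD1 (pos q)) //= big1 => [|j /negPf nej].
  by rewrite posK !mxE !eqxx mulr1 addr0.
by rewrite !mxE eqxx nej mulr0 scale0r.
Qed.

(** * Action of gates and layers on basis states *)

Section Operators.

Variables (C : numClosedFieldType) (n : nat).
Implicit Types (x y c : 'rV['F_2]_n) (a b : 'I_n) (f : 'rV['F_2]_n -> 'rV['F_2]_n -> C).

Lemma op_of_ket f x : op_of f *m ket C x = \col_i f (enum_val i) x.
Proof. by apply/colP => i; rewrite -colE !mxE enum_rankK. Qed.

Lemma ketE x i : ket C x i 0 = (enum_val i == x)%:R.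
Proof. by rewrite mxE eqxx andbT -(inj_eq enum_val_inj) enum_rankK. Qed.

Lemma mx_ket_ext (A B : 'M[C]_(hdim n)) :
  (forall x, A *m ket C x = B *m ket C x) -> A = B.
Proof.
move=> eqAB; apply/matrixP => i j; move/colP/(_ i): (eqAB (enum_val j)).
by rewrite /ket enum_valK -!colE !mxE.
Qed.

Lemma op_of_adj f :
  ((op_of f) ^t* )%sesqui = op_of (fun y x => Num.conj (f x y)).
Proof. by apply/matrixP => i j; rewrite !mxE. Qed.

Lemma op_of_fun_ket (g : 'rV['F_2]_n -> 'rV['F_2]_n) x :
  op_of (fun y x => (y == g x)%:R) *m ket C x = ket C (g x).
Proof. by rewrite op_of_ket; apply/colP => i; rewrite mxE ketE. Qed.

(** By injectivity the adjoint undoes the operator on each basis state, and a one-sided inverse of a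
    square matrix is two-sided. *)
Lemma op_of_fun_unitary (g : 'rV['F_2]_n -> 'rV['F_2]_n) :
  injective g -> (op_of (fun y x => (y == g x)%:R) : 'M[C]_(hdim n)) \is unitarymx.
Proof.
move=> g_inj; apply/unitarymxP/mulmx1C/mx_ket_ext => x.
rewrite mul1mx -mulmxA op_of_fun_ket op_of_adj op_of_ket.
by apply/colP => i; rewrite mxE ketE rmorph_nat (inj_eq g_inj) eq_sym.
Qed.

Lemma relabel_mxE (p : 'S_n) :
  relabel_mx C p = op_of (fun y x => (y == \row_j x 0 (p^-1%g j))%:R).
Proof.
apply/matrixP => i j; rewrite !mxE; congr (nat_of_bool _)%:R.
apply/forallP/eqP => [eq_p|-> a]; last by rewrite mxE permK.
by apply/rowP => a; rewrite mxE -(eqP (eq_p _)) permKV.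
Qed.

Lemma relabel_ket (p : 'S_n) x :
  relabel_mx C p *m ket C x = ket C (\row_j x 0 (p^-1%g j)).
Proof. by rewrite relabel_mxE (op_of_fun_ket (fun x => \row_j x 0 (p^-1%g j))). Qed.

Lemma relabel_unitary (p : 'S_n) : relabel_mx C p \is unitarymx.
Proof.
rewrite relabel_mxE; apply: (op_of_fun_unitary (g := fun x => \row_j x 0 (p^-1%g j))).
by move=> x y /rowP eq_xy; apply/rowP => j; have := eq_xy (p j); rewrite !mxE permK.
Qed.

Lemma cnot_ket a b x :
  gate_mx C (Cnot a b) *m ket C x = ket C (x + x 0 a *: delta_mx 0 b).
Proof. exact: (op_of_fun_ket (fun x => x + x 0 a *: delta_mx 0 b)). Qed.

Lemma cnot_unitary a b : a != b -> gate_mx C (Cnot a b) \is unitarymx.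
Proof.
move=> neq_ab; apply: (op_of_fun_unitary (g := fun x => x + x 0 a *: delta_mx 0 b)).
move=> x y eq_xy; have eq_a : x 0 a = y 0 a.
  by move/rowP/(_ a): eq_xy; rewrite !mxE (negPf neq_ab) andbF !mulr0 !addr0.
by move: eq_xy; rewrite eq_a => /addIr.
Qed.

Lemma F2_ind (P : 'F_2 -> Prop) : P 0 -> P 1 -> forall u, P u.
Proof. by move=> P0 P1 u; rewrite [u]F2_eq01; case: (u != 0). Qed.

Lemma agree_off a x y :
  [forall b, (b != a) ==> (y 0 b == x 0 b)] = (y == x) || (y == x + delta_mx 0 a).
Proof.
apply/forallP/orP => [agree|].
  have off b : b != a -> y 0 b = x 0 b.
    by move=> neq; have := agree b; rewrite neq /= => /eqP.
  have [eq_a|neq_a] := eqVneq (y 0 a) (x 0 a).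
    left; apply/eqP/rowP => b; have [->|] := eqVneq b a; first exact: eq_a.
    exact: off.
  right; apply/eqP/rowP => b; rewrite !mxE /=.
  have [->|neq] := eqVneq b a; last by rewrite addr0 off.
  by elim/F2_ind: (y 0 a) neq_a; elim/F2_ind: (x 0 a) => //= _; apply/val_inj.
case=> /eqP-> b; apply/implyP => neq //.
by rewrite !mxE (negPf neq) addr0.
Qed.

Lemma neq_add_delta a x : (x == x + delta_mx 0 a) = false.
Proof.
apply/eqP => /rowP/(_ a)/eqP.
by rewrite !mxE !eqxx; elim/F2_ind: (x 0 a).
Qed.

Lemma had_ket a x :
  gate_mx C (Had a) *m ket C x =
  (sqrtC 2)^-1 *: ((-1) ^+ (x 0 a == 1) *: ket C x + ket C (x + delta_mx 0 a)).
Proof.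
rewrite op_of_ket; apply/colP => i; rewrite mxE agree_off.
rewrite mxE mxE [X in _ * (X + _)]mxE !ketE.
have [->|neq] := eqVneq (enum_val i) x.
  by rewrite neq_add_delta andbb addr0 mulr1.
have [->|] /= := eqVneq; last by rewrite mulr0 addr0 mulr0.
rewrite mulr0 add0r !mxE !eqxx.
by elim/F2_ind: (x 0 a).
Qed.

(** The matrix is real and symmetric, so unitarity amounts to its square being the identity, checked
    on basis states. *)
Lemma had_unitary a : gate_mx C (Had a) \is unitarymx.
Proof.
have -> : gate_mx C (Had a) \is unitarymx =
    (gate_mx C (Had a) *m gate_mx C (Had a) == 1%:M).
  rewrite qualifE /= op_of_adj; congr (_ *m _ == _).
  apply/matrixP => i j; rewrite !mxE.
  rewrite [in LHS](eq_forallb (P2 := fun b =>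
    (b != a) ==> (enum_val i 0 b == enum_val j 0 b))); last first.
    by move=> b; congr (_ ==> _); exact: eq_sym.
  case: ifP => _; rewrite ?rmorph0 // rmorphM rmorphXn rmorphN1 andbC.
  by congr (_ * _); apply: geC0_conj; rewrite invr_ge0 sqrtC_ge0 ler0n.
apply/eqP/mx_ket_ext => x; rewrite mul1mx -mulmxA had_ket -scalemxAr mulmxDr.
rewrite -scalemxAr !had_ket -addrA.
have -> : delta_mx 0 a + delta_mx 0 a = 0 :> 'rV['F_2]_n.
  by apply/rowP => b; rewrite [LHS]mxE [RHS]mxE addrr_pchar2 // pchar_Fp.
set s := (sqrtC 2)^-1; have ss : s * s * 2 = 1.
  by rewrite /s -invfM -expr2 sqrtCK mulVf // pnatr_eq0.
have -> : (x + delta_mx 0 a) 0 a = x 0 a + 1 by rewrite !mxE !eqxx.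
rewrite addr0; apply/colP => i; move: (ket C x) (ket C (x + _)) => u v.
rewrite !mxE; transitivity (s * s * 2 * u i 0); last by rewrite ss mul1r.
by elim/F2_ind: (x 0 a) => /=; rewrite ?expr0 ?expr1; ring.
Qed.

Lemma foldl_mulmx (T : Type) (F : T -> 'M[C]_(hdim n)) (A : 'M[C]_(hdim n)) l :
  foldl (fun U g => F g *m U) A l = foldl (fun U g => F g *m U) 1%:M l *m A.
Proof.
elim: l A => [|g l IHl] A /=; first by rewrite mul1mx.
by rewrite IHl [in RHS]IHl mulmx1 mulmxA.
Qed.

Lemma foldl_unitary (T : Type) (F : T -> 'M[C]_(hdim n)) (P : pred T) l :
  (forall g, P g -> F g \is unitarymx) -> all P l ->
  foldl (fun U g => F g *m U) 1%:M l \is unitarymx.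
Proof.
move=> unitF; elim: l => [_|g l IHl /= /andP[Pg Pl]].
  by apply/unitarymxP; rewrite mul1mx trmx1 map_mx1.
by rewrite foldl_mulmx mulmx1 mul_unitarymx ?IHl ?unitF.
Qed.

Lemma step_unitary (s : step n) : wf_step s -> step_mx C s \is unitarymx.
Proof.
case: s => [l|p] /=; last by rewrite relabel_unitary.
move=> uniq_l; apply: (foldl_unitary (P := fun g => uniq (gate_qubits g))).
  case=> [a _|a b]; first exact: had_unitary.
  by rewrite /= inE andbT => /cnot_unitary.
elim: l uniq_l => //= g l IHl.
by rewrite cat_uniq => /and3P[-> _ /IHl].
Qed.

Lemma circuit_unitary (c : circuit n) : wf_circuit c -> circuit_mx C c \is unitarymx.
Proof. exact: foldl_unitary step_unitary. Qed.

Lemma circuit_mx_cons s (c : circuit n) :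
  circuit_mx C (s :: c) = circuit_mx C c *m step_mx C s.
Proof. by rewrite /circuit_mx /= foldl_mulmx mulmx1. Qed.

Lemma layer_mx_cons (g : gate n) l : layer_mx C (g :: l) = layer_mx C l *m gate_mx C g.
Proof. by rewrite /layer_mx /= foldl_mulmx mulmx1. Qed.

(** No target is a control, so every gate reads its control bit from the initial word. *)
Lemma cnot_layer_ket (T : eqType) (f h : T -> 'I_n) (s : seq T) x :
  {in s &, forall p q, h p != f q} ->
  layer_mx C [seq Cnot (f p) (h p) | p <- s] *m ket C x =
  ket C (x + \sum_(p <- s) x 0 (f p) *: delta_mx 0 (h p)).
Proof.
elim: s x => [|p s IHs] x disj; first by rewrite big_nil addr0 /layer_mx /= mul1mx.
rewrite map_cons layer_mx_cons -mulmxA cnot_ket IHs => [|q q' qs q's]; last first.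
  by apply: disj; rewrite inE ?qs ?q's orbT.
rewrite big_cons addrA; congr (ket C (_ + _)); apply: eq_big_seq => q qs.
have neq : h p != f q by apply: disj; rewrite inE ?eqxx ?qs ?orbT.
by rewrite !mxE [f q == _]eq_sym (negPf neq) andbF mulr0 addr0.
Qed.

Lemma had_layer_ket (s : seq 'I_n) x :
  uniq s -> (forall a, a \in s -> x 0 a = 0) ->
  layer_mx C [seq Had a | a <- s] *m ket C x =
  (sqrtC 2)^-1 ^+ size s *: \sum_(c in words_on [set a in s]) ket C (x + c).
Proof.
elim: s x => [|a s IHs] x /=.
  move=> _ _; rewrite /layer_mx mul1mx expr0 scale1r (big_pred1 0) ?addr0 // => c.
  apply/words_onP/eqP => [c0|-> j _]; last by rewrite mxE.
  by apply/rowP => j; rewrite c0 ?mxE // inE.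
case/andP=> a_s uniq_s x0.
have x0s b : b \in s -> x 0 b = 0 by move=> bs; rewrite x0 // inE bs orbT.
rewrite layer_mx_cons -mulmxA had_ket x0 ?mem_head // expr0 scale1r.
rewrite -scalemxAr mulmxDr !IHs //; last first.
  move=> b bs; rewrite mxE x0s // !mxE eqxx add0r /=.
  by case: eqP => // eq_ba; rewrite -eq_ba bs in a_s.
rewrite -scalerDr scalerA -exprS; congr (_ *: _).
(* Words supported on [a :: s] split by their bit at [a]: with bit 0 they are supported on [s], with
   bit 1 they become so after a translation by [delta_mx 0 a]. *)
rewrite [RHS](bigID (fun c => c 0 a == 0)) /=; congr (_ + _).
  apply: eq_bigl => c; apply/words_onP/andP => [cs|].
    have ca : c 0 a = 0 by rewrite cs // inE.
    rewrite ca; split => //; apply/words_onP => j.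
    by rewrite !inE negb_or => /andP[_ js]; rewrite cs // inE.
  case=> /words_onP cs /eqP ca j; rewrite inE => js.
  have [->//|neq] := eqVneq j a.
  by rewrite cs // !inE negb_or neq.
rewrite [RHS](reindex_inj (addrI (delta_mx 0 a))) /=.
apply: eq_big => [c|c _]; last by rewrite addrA.
apply/words_onP/andP => [cs|[/words_onP cs]].
  have ca : c 0 a = 0 by rewrite cs // inE.
  split; last by rewrite !mxE !eqxx ca.
  apply/words_onP => j; rewrite !inE negb_or => /andP[neq js].
  by rewrite !mxE (negPf neq) andbF add0r cs // inE.
rewrite !mxE !eqxx /= => ca j; rewrite inE => js; have [->|neq] := eqVneq j a.
  by elim/F2_ind: (c 0 a) ca.
have := cs j; rewrite !inE negb_or neq js => /(_ isT).
by rewrite !mxE (negPf neq) andbF add0r.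
Qed.

End Operators.

(** * The encoding circuit *)

Section EncodingCircuit.

Variables rd rho m : nat.
Implicit Types (p q : {set 'I_m}) (l : 'I_m).

Local Notation active := (stage_active rd rho (m := m)).

Definition stage_layer l : seq (gate (2 ^ m)) :=
  [seq Cnot (pos p) (pos (l |: p)) | p <- enum [set p | active l p]].

Lemma mul_row_delta (x : 'rV['F_2]_(2 ^ m)) a b :
  x *m delta_mx a b = x 0 a *: delta_mx 0 b :> 'rV_(2 ^ m).
Proof.
apply/rowP => j; rewrite !mxE (bigD1 a) //= big1 => [|i neq].
  by rewrite mxE !eqxx addr0.
by rewrite mxE (negPf neq) mulr0.
Qed.

Lemma stage_layer_ket (C : numClosedFieldType) l (x : 'rV['F_2]_(2 ^ m)) :
  layer_mx C (stage_layer l) *m ket C x = ket C (x *m stage_mx rd rho l).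
Proof.
rewrite (@cnot_layer_ket C _ _ (@pos m) (fun p => pos (l |: p))).
  congr (ket C _); rewrite mulmxDr mulmx1 mulmx_sumr big_enum /=; congr (_ + _).
  by apply: eq_big => [p|p _]; rewrite ?inE // mul_row_delta.
move=> p q _; rewrite mem_enum inE => /andP[lq _]; rewrite (inj_eq (@pos_inj m)).
by apply: contraNneq lq => <-; rewrite setU11.
Qed.

(** Controls avoid [l] and targets contain it, and adding [l] is injective on sets that avoid it. *)
Lemma stage_layer_wf l : wf_step (Layer (stage_layer l)).
Proof.
rewrite /= -map_comp.
have perm_st (s : seq {set 'I_m}) :
    perm_eq (flatten [seq [:: pos p; pos (l |: p)] | p <- s])
            (map (@pos m) s ++ map (fun p => pos (l |: p)) s).
  elim: s => //= p s IHs; rewrite perm_cons perm_sym.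
  by rewrite (perm_catCA _ [:: pos (l |: p)]) /= perm_cons perm_sym.
rewrite (perm_uniq (perm_st _)) cat_uniq (map_inj_uniq (@pos_inj m)) enum_uniq /=.
apply/andP; split.
  apply/hasPn => _ /mapP[p _ ->]; apply/mapP => -[q]; rewrite mem_enum inE.
  by case/andP=> lq _ /pos_inj eq_q; rewrite -eq_q setU11 in lq.
rewrite map_inj_in_uniq ?enum_uniq // => p q; rewrite !mem_enum !inE.
by case/andP=> lp _ /andP[lq _] /pos_inj/(congr1 (fun s => s :\ l)); rewrite !setU1K.
Qed.

Lemma card_stage_weight l :
  #|[set q : {set 'I_m} | (q \subset from m l.+1) && stage_weight rd rho m l #|q|]|
  = (\sum_(j < rd.+1 | stage_weight rd rho m l j) 'C(m - l.+1, j))%N.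
Proof.
(* [inord] keeps the cardinal here, since [stage_weight] bounds it by [rd]. *)
rewrite -sum1_card (partition_big (fun q => inord #|q| : 'I_rd.+1)
  (fun j => stage_weight rd rho m l j)) /=; last first.
  by move=> q; rewrite inE => /andP[_ w]; rewrite inordK // ltnS; case/andP: w.
apply: eq_bigr => j wj; rewrite sum1_card -card_from -cards_draws.
apply: eq_card => q; rewrite unfold_in /= !inE; apply/andP/andP => [[]|[q_l /eqP q_j]].
  by case/andP=> -> /andP[q_rd _] /eqP eq_j; rewrite -eq_j inordK.
by rewrite q_l q_j wj inord_val.
Qed.

(** A set avoiding [l] splits uniquely into a part below [l], which is arbitrary, and a part above
    [l], which alone decides whether the gate is kept. *)
Lemma card_stage_active l : #|[set p | active l p]| = stage_count rd rho m l.
Proof.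
have low_l : #|~: from m l| = l.
  have := cardsC (from m l); rewrite card_from card_ord.
  by have := ltn_ord l; lia.
rewrite /stage_count -{1}low_l -card_powerset -card_stage_weight -cardsX.
have split_l p : l \notin p -> p = (p :&: ~: from m l) :|: (p :&: from m l.+1).
  move=> lp; apply/setP => i; rewrite !inE -andb_orr -ltnNge.
  have [->|neq] := eqVneq i l; first by rewrite (negPf lp).
  by move: neq; rewrite -val_eqE neq_ltn => ->; rewrite andbT.
rewrite -(card_in_imset (f := fun ab => ab.1 :|: ab.2)).
  apply: eq_card => p; rewrite inE; apply/andP/imsetP => [[lp w]|].
    exists (p :&: ~: from m l, p :&: from m l.+1); last exact: split_l.
    by rewrite !inE /= !subsetIr.
  case=> -[a b]; rewrite !inE /= => /andP[a_l /andP[b_l w]] ->.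
  have l_a : l \notin a.
    by apply/negP => /(subsetP a_l); rewrite !inE leqnn.
  have l_b : l \notin b by apply/negP => /(subsetP b_l); rewrite !inE ltnn.
  rewrite inE (negPf l_a) (negPf l_b); split=> //.
  suff -> : (a :|: b) :&: from m l.+1 = b by [].
  rewrite setIUl (setIidPl b_l) (_ : a :&: _ = set0) ?set0U //.
  apply/setP => i; rewrite !inE; apply/negP => /andP[/(subsetP a_l)].
  by rewrite !inE -ltnNge; lia.
have proj (a b : {set 'I_m}) : a \subset ~: from m l -> b \subset from m l.+1 ->
    (a :|: b) :\: from m l = a /\ (a :|: b) :&: from m l = b.
  move=> /subsetP a_l /subsetP b_l; split; apply/setP => i.
    rewrite !inE; have [/a_l|_] := boolP (i \in a).
      by rewrite !inE andbT.
    by have [/b_l|_] := boolP (i \in b); rewrite ?andbF // !inE => /ltnW ->.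
  rewrite !inE; have [/b_l|_] := boolP (i \in b).
    by rewrite !inE orbT => /ltnW.
  by have [/a_l|_] := boolP (i \in a); rewrite // !inE => /negPf.
move=> [a b] [a' b']; rewrite !inE /= => /andP[a_l /andP[b_l _]].
case/andP=> a'_l /andP[b'_l _] eq_ab.
have [ea eb] := proj a b a_l b_l; have [ea' eb'] := proj a' b' a'_l b'_l.
by congr (_, _); [rewrite -ea -ea' eq_ab | rewrite -eb -eb' eq_ab].
Qed.

Definition butterfly_circuit (ls : seq 'I_m) : circuit (2 ^ m) :=
  [seq Layer (stage_layer l) | l <- ls].

Lemma butterfly_circuit_ket (C : numClosedFieldType) ls (x : 'rV['F_2]_(2 ^ m)) :
  circuit_mx C (butterfly_circuit ls) *m ket C x =
  ket C (x *m butterfly_mx rd rho ls).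
Proof.
elim: ls x => [|l ls IHls] x; first by rewrite /circuit_mx /= mul1mx mulmx1.
by rewrite /= circuit_mx_cons -mulmxA stage_layer_ket IHls mulmxA.
Qed.

Definition encoding_circuit (p : 'S_(2 ^ m)) : circuit (2 ^ m) :=
  Relabel p :: Layer [seq Had a | a <- enum (low_degree rho m)]
    :: butterfly_circuit (enum 'I_m).

Lemma encoding_circuit_wf (p : 'S_(2 ^ m)) : wf_circuit (encoding_circuit p).
Proof.
rewrite /wf_circuit /= -map_comp; apply/andP; split; last first.
  by rewrite all_map; apply/allP => l _; apply: stage_layer_wf.
by rewrite (eq_map (g := fun a => [:: a])) // flatten_seq1 enum_uniq.
Qed.

Lemma encoding_circuit_depth (p : 'S_(2 ^ m)) : depth (encoding_circuit p) = m.+1.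
Proof.
rewrite /depth /= add0n add1n; congr _.+1; rewrite count_map.
by rewrite (eq_count (a2 := predT)) // count_predT size_enum_ord.
Qed.

Lemma encoding_circuit_count (p : 'S_(2 ^ m)) :
  cnot_count (encoding_circuit p) = butterfly_count rd rho m.
Proof.
rewrite /cnot_count /= add0n count_map (eq_count (a2 := pred0)) // count_pred0.
rewrite add0n /butterfly_count sumnE 2!big_map big_enum /=.
apply: eq_bigr => l _; rewrite count_map (eq_count (a2 := predT)) // count_predT.
by rewrite -cardE card_stage_active.
Qed.

Lemma sqrtC_expn (C : numClosedFieldType) k :
  sqrtC ((2 ^ k)%:R : C) = sqrtC 2 ^+ k.
Proof.
rewrite natrX -{1}[2%:R]sqrtCK -exprM mulnC exprM sqrCK //.
by rewrite exprn_ge0 // sqrtC_ge0 ler0n.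
Qed.

(** The Hadamard layer superposes all translates of [y] by low-degree words; the butterfly sends
    these to the coset of [y *m B] modulo the code, which is the coset of [w]. *)
Lemma encoding_circuit_ket (C : numClosedFieldType) (p : 'S_(2 ^ m))
    (x : 'rV['F_2]_(2 ^ m)) (w : 'rV['F_2]_(2 ^ m)) :
  (rho <= rd.+1)%N ->
  (forall j, j \in low_degree rho m -> x 0 (p^-1%g j) = 0) ->
  (\row_j x 0 (p^-1%g j)) *m butterfly_mx rd rho (enum 'I_m) - w
    \in half_eval_span m rho 0 ->
  circuit_mx C (encoding_circuit p) *m ket C x = ketRM C (rho%:Z - 1) w.
Proof.
move=> le_rho x_low; set y := \row_j _; set B := butterfly_mx _ _ _ => yB_w.
rewrite !circuit_mx_cons -!mulmxA relabel_ket -/y.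
rewrite had_layer_ket ?enum_uniq // => [|j]; last first.
  by rewrite mem_enum mxE; apply: x_low.
rewrite -scalemxAr mulmx_sumr /ketRM -(butterfly_mx_low_degree (rd := rd)) // -/B.
have B_inj : injective (fun c : 'rV['F_2]_(2 ^ m) => c *m B).
  by move=> u v; apply: butterfly_mx_inj.
(* The code has [2 ^ h] words, where [h] is the number of Hadamard gates, so the normalizations
   agree. *)
rewrite card_imset // card_words_on sqrtC_expn -cardE exprVn; congr (_ *: _).
rewrite (_ : [set a in enum _] = low_degree rho m); last first.
  by apply/setP => j; rewrite inE mem_enum.
transitivity (\sum_(c in RM (rho%:Z - 1) m) ket C (y *m B + c)).
  rewrite -(butterfly_mx_low_degree (rd := rd)) // big_imset //=; last first.
    by move=> u v _ _; apply: B_inj.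
  by apply: eq_bigr => c _; rewrite butterfly_circuit_ket mulmxDl.
rewrite -/B butterfly_mx_low_degree // RM_half_eval_span.
(* Translation by this codeword permutes the code and turns [w + c] into [y *m B + c]. *)
rewrite [RHS](reindex_inj (addrI (y *m B - w))) /=.
apply: eq_big => [c|c _]; last by rewrite addrA addrC [w + _]addrC subrK addrC.
by rewrite !inE rpredDl.
Qed.

End EncodingCircuit.

(** * Placing the message on its monomials, and the theorem *)

Lemma extend_injection_perm k n (f : 'I_k -> 'I_n) :
  injective f ->
  exists p : 'S_n, forall (i : 'I_k) (j : 'I_n), val j = val i -> p j = f i.
Proof.
(* The values of [f], followed by all other indices, enumerate ['I_n] without repetition. *)
move=> f_inj; pose s := codom f ++ [seq j <- enum 'I_n | j \notin codom f].
have s_uniq : uniq s.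
  have f_uniq : uniq (codom f) by apply/injectiveP.
  rewrite cat_uniq f_uniq filter_uniq ?enum_uniq // andbT.
  by apply/hasPn => j; rewrite mem_filter => /andP[].
have s_size : size s = n.
  rewrite -[RHS](size_enum_ord n); apply/perm_size/uniq_perm => //.
    exact: enum_uniq.
  by move=> j; rewrite mem_cat mem_filter !mem_enum andbT orbN.
have g_inj : injective (fun j : 'I_n => nth j s j).
  move=> j1 j2; rewrite (set_nth_default j1 j2) ?s_size // => /eqP.
  by rewrite nth_uniq ?s_size // => /eqP/val_inj.
exists (perm g_inj) => i j eq_ij.
have lt_jk : (j < k)%N by rewrite -[(j : nat)]/(val j) eq_ij; exact: ltn_ord i.
rewrite permE nth_cat size_codom card_ord lt_jk codomE (nth_map i) ?size_enum_ord //.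
by congr f; apply/val_inj; rewrite /= nth_enum_ord.
Qed.

Lemma pad0_perm k n (f : 'I_k -> 'I_n) (p : 'S_n) (v : 'rV['F_2]_k) :
  injective f ->
  (forall (i : 'I_k) (j : 'I_n), val j = val i -> p j = f i) ->
  \row_j pad0 n v 0 (p^-1%g j) = \sum_i v 0 i *: delta_mx 0 (f i).
Proof.
move=> f_inj pf; have le_kn : (k <= n)%N.
  by rewrite -[k]card_ord -[n]card_ord; apply: leq_card f_inj.
apply/rowP => j; rewrite !mxE summxE; case: insubP => [i _ eq_i|ge_k].
  have -> : j = f i by rewrite -(pf i (p^-1%g j)) ?permKV.
  rewrite (bigD1 i) //= big1 => [|i' neq]; first by rewrite !mxE !eqxx mulr1 addr0.
  by rewrite !mxE (inj_eq f_inj) eq_sym (negPf neq) andbF mulr0.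
rewrite big1 // => i _; rewrite !mxE; case: (j =P f i) => [eq_j|]; last by rewrite andbF mulr0.
(* Were [j] equal to [f i], its source under [p] would be [i], a message position and not
   padding. *)
case/negP: ge_k; rewrite eq_j -(pf i (widen_ord le_kn i)) // permK.
exact: ltn_ord i.
Qed.

Theorem mainTheorem7 :
  exists K : nat,
  forall (R : realType) (rd md t : nat) (r : int) (m : nat),
    (rd < md)%N ->
    (t <= minn rd.+1 (md - rd))%N ->
    r = rd%:Z - t%:Z ->
    m%:Z = md%:Z - t%:Z ->
  forall ms : (msg_len r m rd).-tuple 'X_{1..m},
    monomial_order r rd ms ->
  exists (U : 'M[R[i]]_(hdim (2 ^ m))) (c : circuit (2 ^ m)),
    [/\ is_encoder ms U,
        wf_circuit c,
        U = circuit_mx R[i] c,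
        (depth c <= K * m.+1)%N
      & cnot_count c = zeta0 rd md r m].
Proof.
(* [K = 1] suffices: one Hadamard layer and [m] butterfly layers. *)
exists 1%N => R rd md t r m lt_rd le_t r_eq m_eq.
(* [rho] is [r + 1], a natural number even when [r = -1]. *)
pose rho := (rd.+1 - t)%N.
have le_t' : (t <= rd.+1)%N /\ (t <= md - rd)%N by apply/andP; rewrite -leq_min.
have r_rho : r = rho%:Z - 1 by rewrite /rho; lia.
have m_sub : m = (md - t)%N by lia.
have rho_eq : rho%:Z - 1 = rd%:Z - t%:Z by rewrite -r_rho.
rewrite {}r_rho {r r_eq} => ms [ms_uniq ms_mem].
have msP i : [/\ forall a, (tnth ms i a <= 1)%N, (rho <= mdeg (tnth ms i))%N
                & (mdeg (tnth ms i) <= rd)%N].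
  have := ms_mem (tnth ms i); rewrite mem_tnth => /esym/and3P[/forallP sqf lt_r le_r].
  by split=> //; lia.
pose f i := pos (mnm_support (tnth ms i)).
have f_inj : injective f.
  move=> i j /pos_inj eq_ij; apply/val_inj/eqP.
  have [sqf_i _ _] := msP i; have [sqf_j _ _] := msP j.
  have := mnm_support_inj sqf_i sqf_j eq_ij.
  rewrite !(tnth_nth 0%MM) => /eqP.
  by rewrite nth_uniq // size_tuple ltn_ord.
have [p pf] := extend_injection_perm f_inj.
pose c := encoding_circuit rd rho p.
exists (circuit_mx R[i] c), c; split=> //.
- split; first exact/circuit_unitary/encoding_circuit_wf.
  move=> v; have x_eq := pad0_perm v f_inj pf.
  apply: encoding_circuit_ket; first by rewrite /rho leq_subr.
    (* Message monomials have degree at least [rho], so the qubits receiving Hadamard gates start at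
       zero. *)
    move=> j j_low; move/rowP/(_ j): x_eq; rewrite mxE => ->.
    rewrite summxE big1 // => i _; rewrite !mxE; case: (j =P f i) => [eq_j|].
      move: j_low; have [sqf ge_rho _] := msP i.
      by rewrite eq_j inE posK card_mnm_support_sqfree // ltnNge ge_rho.
    by rewrite andbF mulr0.
  (* By linearity it is enough to compare each placed unit word with the corresponding row of
     G_1. *)
  rewrite x_eq mulmx_suml mulmx_sum_row -sumrB memv_suml // => i _.
  rewrite rowK -scalemxAl -scalerBr memvZ // eval_vec_monomial.
  apply: butterfly_mx_unit; have [sqf _ le_rd'] := msP i.
  by rewrite card_mnm_support_sqfree.
- exact: encoding_circuit_wf.
- by rewrite encoding_circuit_depth mul1n.
by rewrite encoding_circuit_count rho_eq m_sub zeta0E.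
Qed.
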